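(* Every matrix $A\in U(2)$ has a biunimodular vector.
   Context: A biunimodular vector for $A\in U(n)$ is a vector $v\in\mathbb{C}^n$ such that both $v$ and $Av$ have all entries of modulus one. *)

(* Defs.v *)
From mathcomp Require Import all_boot all_order all_algebra.
From mathcomp Require Import reals.
From mathcomp Require Export complex.

Set Implicit Arguments.
Unset Strict Implicit.
Unset Printing Implicit Defensive.

Import GRing.Theory Num.Theory.
Local Open Scope ring_scope.

(* Note that `|z| is the modulus of z, seen as an element of R[i]. *)
Definition unimodular (R : realType) (n : nat) (v : 'cV[R[i]]_n) : Prop :=
  forall i : 'I_n, `|v i 0| = 1.

Definition biunimodular (R : realType) (n : nat) (A : 'M[R[i]]_n)
    (v : 'cV[R[i]]_n) : Prop :=
  unimodular v /\ unimodular (A *m v).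

(* Main.v *)
Require Import Defs.
From mathcomp Require Import all_boot all_order all_algebra.
From mathcomp Require Import reals.
From mathcomp Require Import ring.

(** For v = (1, u) with |u| = 1, an entry of A v has squared modulus
    |a + b u|^2 = |a|^2 + |b|^2 + 2 Re (conj a * b * u), where (a, b) is a unit
    row of A. Orthogonality of the columns makes the products conj a * b of the
    two rows opposite, so rotating u until one of the cross terms vanishes makes
    both vanish. *)

Import GRing.Theory Num.Theory.

Local Open Scope ring_scope.

(** A vanishing real part is written [w + w^* = 0], the form in which the cross term arises in
    [norm_addM_eq1]. *)
Lemma exists_unimodular_mul_imaginary (C : numClosedFieldType) (z : C) :
  exists2 u : C, `|u| = 1 & z * u + (z * u)^* = 0.
Proof.
have [-> | z_neq0] := eqVneq z 0.
  by exists 1; rewrite ?normr1 // mul0r rmorph0 addr0.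
have nz_neq0 : `|z| != 0 by rewrite normr_eq0.
(* The factor [z^*] cancels the argument of [z], and ['i] adds a quarter turn. *)
exists ('i * z^* / `|z|).
  by rewrite normf_div normrM normCi norm_conjC normr_id mul1r divff.
have -> : z * ('i * z^* / `|z|) = 'i * `|z|.
  by rewrite mulrA mulrCA -normCK expr2 mulrA mulfK.
by rewrite rmorphM /= conjCi (CrealP (normr_real z)) mulNr subrr.
Qed.

Lemma norm_addM_eq1 (C : numClosedFieldType) (a b u : C) :
  `|u| = 1 -> a * a^* + b * b^* = 1 -> a^* * b * u + (a^* * b * u)^* = 0 ->
  `|a + b * u| = 1.
Proof.
move=> u1 ab1; rewrite !rmorphM /= conjCK => cross0.
have uu1 : u * u^* = 1 by rewrite -normCK u1 expr1n.
apply/eqP; rewrite -(@eqrXn2 _ 2) ?normr_ge0 ?ler01 // expr1n normCK.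
rewrite rmorphD rmorphM /=; apply/eqP.
transitivity (a * a^* + b * b^* * (u * u^*)
              + (a^* * b * u + a * b^* * u^*)); first by ring.
by rewrite uu1 mulr1 ab1 cross0 addr0.
Qed.

Theorem proposition5p1 (R : realType) (A : 'M[R[i]]_2) (hA : A \is unitarymx) :
  exists v : 'cV[R[i]]_2, biunimodular A v.
Proof.
(* A one-sided inverse of a square matrix is two-sided, so orthonormal rows give orthonormal
   columns. *)
have /unitarymxP rowA := hA; have colA := mulmx1C rowA.
have lift01 : lift ord0 ord0 = 1 :> 'I_2 by apply/val_inj.
have row1 i : A i 0 * (A i 0)^* + A i 1 * (A i 1)^* = 1.
  have := congr1 (fun M : 'M_2 => M i i) rowA.
  by rewrite !mxE eqxx big_ord_recl big_ord1 !mxE lift01.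
have col0 : (A 0 0)^* * A 0 1 + (A 1 0)^* * A 1 1 = 0.
  have := congr1 (fun M : 'M_2 => M 0 1) colA.
  by rewrite !mxE big_ord_recl big_ord1 !mxE lift01.
have [u u1 imag0] := exists_unimodular_mul_imaginary _ ((A 0 0)^* * A 0 1).
have imag1 : (A 1 0)^* * A 1 1 * u + ((A 1 0)^* * A 1 1 * u)^* = 0.
  (* By [col0], the product for row 1 is the opposite of that for row 0. *)
  have /eqP := col0; rewrite addrC addr_eq0 => /eqP ->.
  by rewrite mulNr rmorphN -opprD imag0 oppr0.
exists (\col_i if i == 0 then 1 else u); split=> i.
  by rewrite mxE; case: ifP => _; rewrite ?normr1.
rewrite mxE big_ord_recl big_ord1 !mxE /= mulr1 lift01.
apply: norm_addM_eq1 => //.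
(* Only the cross term remains: [imag0] for row 0, [imag1] for row 1. *)
by case: (unliftP 0 i) => [j|] -> //; rewrite ord1 lift01.
Qed.
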